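(* Let $\mathcal X$ be a finite state space, $\mathcal H:\mathcal X\to\mathbb R$, $Q$ a symmetric irreducible generator on $\mathcal X$, and let $f,c,\alpha$ satisfy the standing assumption described in the context, with the penalty parameter $\alpha>0$ held constant in time. Then: (1) (Large $\alpha$ leads to fast convergence) For $x\in\mathcal X$ and $t\ge 0$, $$\frac12 e^{-\lambda_2(-M^f_{1,\alpha,c})t}\le \left\|(P^f_{1,\alpha,c})^t(x,\cdot)-\mu^f_{1,\alpha,c}\right\|_{TV}\le \frac{e^{\mathcal H_{\max}-\mathcal H_{\min}}\,|\mathcal X|}{2}\,e^{-\lambda_2(-M^f_{1,\alpha,c})t}.$$ (2) (Small $\alpha$ gives small total variation bias) $$\|\mu^f_{1,\alpha,c}-\mu\|_{TV}=\mathcal O(\alpha),$$ i.e. for fixed $\mathcal X,\mathcal H,f,c$ the total variation distance is bounded by a constant (not depending on $\alpha$) times $\alpha$.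
   Context: Setting. $\mathcal X$ is a finite set, $\mathcal H:\mathcal X\to\mathbb R$ a function (Hamiltonian), $\mathcal H_{\min}=\min_x\mathcal H(x)$, $\mathcal H_{\max}=\max_x\mathcal H(x)$, and $\mu(x)\propto e^{-\mathcal H(x)}$ the target probability distribution. $Q$ is a symmetric irreducible generator (rate matrix) on $\mathcal X$ (the proposal chain). Standing assumption: $f:\mathbb R^+\to\mathbb R^+$ is differentiable, non-negative, non-decreasing with $f(0)=0$; the threshold $c\in\mathbb R$ satisfies $\mathcal H_{\min}\le c\le\mathcal H_{\max}$; the penalty parameter satisfies $\alpha\ge0$ (here it is a fixed value $\alpha>0$). Landscape-modified Hamiltonian: $\mathcal H^f_{1,\alpha,c}(x)=\int_{\mathcal H_{\min}}^{\mathcal H(x)}\frac{1}{\alpha f((u-c)_+)+1}\,du$, where $y_+=\max\{y,0\}$. Modified target: $\mu^f_{1,\alpha,c}(x)=e^{-\mathcal H^f_{1,\alpha,c}(x)}/Z^f_{1,\alpha,c}$ with $Z^f_{1,\alpha,c}=\sum_{x}e^{-\mathcal H^f_{1,\alpha,c}(x)}$. Modified Metropolis-Hastings generator: $M^f_{1,\alpha,c}(x,y)=Q(x,y)e^{-(\mathcal H^f_{1,\alpha,c}(y)-\mathcal H^f_{1,\alpha,c}(x))_+}$ for $x\ne y$, and $M^f_{1,\alpha,c}(x,x)=-\sum_{y\neq x}M^f_{1,\alpha,c}(x,y)$. It is reversible with respect to $\mu^f_{1,\alpha,c}$; $((P^f_{1,\alpha,c})^t)_{t\ge0}$ denotes its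 transition semigroup. Spectral gap: $\lambda_2(-M^f_{1,\alpha,c})=\inf\{\langle -M^f_{1,\alpha,c}g,g\rangle_{\mu^f_{1,\alpha,c}}/\langle g,g\rangle_{\mu^f_{1,\alpha,c}}: g\ne0,\ \mu^f_{1,\alpha,c}(g)=0\}$, with $\langle g_1,g_2\rangle_\nu=\sum_x g_1(x)g_2(x)\nu(x)$ and $\nu(g)=\sum_x g(x)\nu(x)$. Total variation: $\|\nu_1-\nu_2\|_{TV}=\frac12\sum_x|\nu_1(x)-\nu_2(x)|$.
   Formalization: The lower bound in (1) is stated for the maximum over starting states x of the total variation distance, and only when X has at least two states; for every single x it is false (at t=0 the distance is 1-μ^f(x), possibly below 1/2), and for one state the gap is undefined. *)

(* Defs.v *)
From mathcomp Require Export all_boot all_order all_algebra.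
From mathcomp Require Export all_classical all_reals all_analysis.
Export Order.TTheory GRing.Theory Num.Theory.
Export numFieldNormedType.Exports.

Set Implicit Arguments.
Unset Strict Implicit.
Unset Printing Implicit Defensive.

Local Open Scope classical_set_scope.
Local Open Scope ring_scope.

(** * Finite state space: kernels, measures, semigroups *)

Section FiniteChain.
Context {R : realType} {X : finType}.
Implicit Types (M Q : X -> X -> R) (U g nu : X -> R).

Definition generator Q : Prop :=
  (forall x y, x != y -> 0 <= Q x y) /\ (forall x, \sum_y Q x y = 0).

Definition symmetric_kernel Q : Prop := forall x y, Q x y = Q y x.

(** The diagonal of a generator is nonpositive, so only genuine jumps
    contribute edges. *)
Definition irreducible_kernel Q : Prop :=
  forall x y, connect (fun u v => 0 < Q u v) x y.

(** [\matrix] needs an ordinal index: states are enumerated by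
    [enum_val : 'I_#|X| -> X], with inverse [enum_rank]. *)
Definition kernel_mx M : 'M[R]_#|X| :=
  \matrix_(i, j) M (enum_val i) (enum_val j).

(** The transition semigroup [exp (t M)], as the entrywise sum of the
    exponential series. *)
Definition semigroup M (t : R) (x y : X) : R :=
  limn (series (fun k : nat =>
    t ^+ k / k`!%:R * (kernel_mx M ^+ k) (enum_rank x) (enum_rank y))).

Definition gibbs U : X -> R :=
  fun x => expR (- U x) / \sum_y expR (- U y).

(** Metropolis-Hastings generator with proposal [Q] and energy [U]. *)
Definition metropolis Q U : X -> X -> R := fun x y =>
  let off z := Q x z * expR (- Num.max (U z - U x) 0) in
  if x == y then - \sum_(z | z != x) off z else off y.

Definition mean nu g : R := \sum_x g x * nu x.

Definition inner nu g1 g2 : R := \sum_x g1 x * g2 x * nu x.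

Definition neg_gen M g : X -> R := fun x => - \sum_y M x y * g y.

(** Infimum of the Rayleigh quotients.  When [#|X| <= 1] there is no
    admissible [g] and the library convention [inf set0 = 0] applies. *)
Definition spectral_gap M nu : R :=
  inf [set inner nu (neg_gen M g) g / inner nu g g
      | g in [set g : X -> R | g <> (fun=> 0) /\ mean nu g = 0]].

Definition tv_dist nu1 nu2 : R := 2^-1 * \sum_x `|nu1 x - nu2 x|.

(** [X] being finite, these are a minimum and a maximum when [X] is
    nonempty. *)
Definition Hmin U : R := inf (range U).
Definition Hmax U : R := sup (range U).

End FiniteChain.

(** * Landscape modification *)

Section Landscape.
Context {R : realType}.

(** Differentiability on the closed half-line: the difference quotient is
    restricted to nonnegative points, so it is one-sided at 0. *)
Definition differentiable_halfline (f : R -> R) : Prop :=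
  forall x, 0 <= x ->
    cvg ((fun y => (f y - f x) / (y - x)) @ within [set y | 0 <= y] x^').

(** [f] stands for a map from [0, +oo) to [0, +oo); its values at negative
    arguments are unconstrained and never used. *)
Definition admissible_penalty (f : R -> R) : Prop :=
  [/\ differentiable_halfline f,
      forall x, 0 <= x -> 0 <= f x,
      forall x y, 0 <= x -> x <= y -> f x <= f y
    & f 0 = 0].

Context {X : finType}.

(** Since [Hmin H <= H x], the oriented integral is the Lebesgue integral
    over [`[Hmin H, H x]]. *)
Definition modified_H (f : R -> R) (alpha c : R) (H : X -> R) : X -> R :=
  fun x => Rintegral lebesgue_measure `[Hmin H, H x]
    (fun u => (alpha * f (Num.max (u - c) 0) + 1)^-1).

Definition modified_mu (f : R -> R) (alpha c : R) (H : X -> R) : X -> R :=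
  gibbs (modified_H f alpha c H).

Definition modified_MH (Q : X -> X -> R) (f : R -> R) (alpha c : R)
    (H : X -> R) : X -> X -> R :=
  metropolis Q (modified_H f alpha c H).

Definition modified_gap (Q : X -> X -> R) (f : R -> R) (alpha c : R)
    (H : X -> R) : R :=
  spectral_gap (modified_MH Q f alpha c H) (modified_mu f alpha c H).

(** Distance to equilibrium at time [t] when the chain starts at [x]. *)
Definition tv_to_eq (Q : X -> X -> R) (f : R -> R) (alpha c : R)
    (H : X -> R) (t : R) (x : X) : R :=
  tv_dist (semigroup (modified_MH Q f alpha c H) t x)
          (modified_mu f alpha c H).

End Landscape.

(* Main.v *)
Require Import Defs.
From mathcomp Require Import ring lra.

(* For a mean-zero function g the energy |P_t g|^2 in L^2(nu) has derivative
   -2 <-M P_t g, P_t g>, which is at most -2 lambda |P_t g|^2, so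
   exp(2 lambda t) |P_t g|^2 is nonincreasing.  Taking
   g = delta_x / nu(x) - 1, reversibility gives P_t g(y) = P_t(x,y)/nu(y) - 1,
   and the L^1 norm is at most the L^2 norm; this is the upper bound, with
   constant 1 / (2 nu(x)).

   By compactness the infimum defining the gap is attained, and the first
   variation at a minimiser g gives M g = - lambda g, hence
   P_t g = exp(- lambda t) g; evaluating at a point where |g| is maximal gives
   the lower bound.

   For the bias, 1/(1+z) >= 1-z shows that the modified energy differs from
   H - Hmin by at most alpha f(Hmax - c) (Hmax - Hmin), and a Gibbs measure
   depends on its energy in a Lipschitz way. *)

Set Implicit Arguments.
Unset Strict Implicit.
Unset Printing Implicit Defensive.

Local Open Scope classical_set_scope.
Local Open Scope ring_scope.

(** * Exponential generating series *)

Section ExponentialSeries.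
Context {R : realType}.
Implicit Types (a : nat -> R) (t s : R).

(** The summand has the shape used in [semigroup], so [semigroupE] holds by conversion and
    identities for the semigroup reduce to identities between coefficient sequences. *)
Definition expsum a t : R := limn (series (fun k => t ^+ k / k`!%:R * a k)).

(** Gives convergence of [expsum] for every [t] and survives shifts and finite linear combinations;
    entries of matrix powers satisfy it. *)
Definition geometric_growth a : Prop :=
  exists B C : R, 0 <= C /\ forall k, `|a k| <= B * C ^+ k.

Lemma geometric_growthS a :
  geometric_growth a -> geometric_growth (fun k => a k.+1).
Proof.
move=> [B [C [C0 aBC]]]; exists (B * C), C; split=> // k.
by rewrite -mulrA -exprS.
Qed.

Lemma geometric_growth_sum (I : finType) (g : I -> R) (a : I -> nat -> R) :
  (forall i, geometric_growth (a i)) ->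
  geometric_growth (fun k => \sum_i g i * a i k).
Proof.
move=> /choice[B /choice[C BC]].
exists (\sum_i `|g i| * `|B i|), (\sum_i C i); split.
  by apply: sumr_ge0 => i _; case: (BC i).
move=> k; apply: le_trans (ler_norm_sum _ _ _) _.
rewrite big_distrl /=; apply: ler_sum => i _.
have [C0 aBC] := BC i.
rewrite normrM -mulrA ler_wpM2l //; apply: le_trans (aBC k) _.
apply: le_trans (ler_norm _) _; rewrite normrM ler_wpM2l // normrX.
rewrite ger0_norm // lerXn2r ?nnegrE //.
  by apply: sumr_ge0 => j _; case: (BC j).
by rewrite (bigD1 i) //= lerDl; apply: sumr_ge0 => j _; case: (BC j).
Qed.

Lemma cvg_expsum a t : geometric_growth a ->
  cvgn (series (fun k => t ^+ k / k`!%:R * a k)).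
Proof.
move=> [B [C [C0 aBC]]]; apply: normed_cvg.
pose v k := `|B| * (`|t| * C) ^+ k / k`!%:R.
apply: (@series_le_cvg _ _ v) => [k|k|k|].
- exact: normr_ge0.
- by rewrite /v divr_ge0 // mulr_ge0 // exprn_ge0 // mulr_ge0.
- rewrite /v /= normrM normrM normfV normrX normr_nat exprMn.
  apply: (@le_trans _ _ (`|t| ^+ k / k`!%:R * (`|B| * C ^+ k))).
    apply: ler_wpM2l; first by rewrite divr_ge0 // exprn_ge0.
    by apply: le_trans (aBC k) _; rewrite ler_wpM2r ?exprn_ge0 // ler_norm.
  by rewrite le_eqVlt; apply/orP; left; apply/eqP; ring.
- rewrite (_ : v = `|B| *: exp_coeff (`|t| * C)).
    by apply: is_cvg_seriesZ; exact: is_cvg_series_exp_coeff.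
  by apply/funext => k; rewrite /v /exp_coeff /= !fctE /GRing.scale /= mulrA.
Qed.

Lemma expsum_sum (I : finType) (g : I -> R) (a : I -> nat -> R) t :
  (forall i, geometric_growth (a i)) ->
  \sum_i g i * expsum (a i) t = expsum (fun k => \sum_i g i * a i k) t.
Proof.
move=> ha; apply/esym/cvg_lim => //.
rewrite (_ : series _ = fun n => \sum_i g i *
    series (fun k => t ^+ k / k`!%:R * a i k) n).
  apply: cvg_big => [|i _]; first exact: add_continuous.
  by apply: cvgM; [exact: cvg_cst | exact: cvg_expsum].
apply/funext => n; rewrite /series /=.
under [RHS]eq_bigr do rewrite big_distrr /=.
rewrite exchange_big /=; apply: eq_bigr => k _; rewrite big_distrr /=.
by apply: eq_bigr => i _; ring.
Qed.

Lemma expsum_geometric s (b t : R) :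
  expsum (fun k => s ^+ k * b) t = expR (s * t) * b.
Proof.
apply: cvg_lim => //.
rewrite (_ : series _ = fun n => series (exp_coeff (s * t)) n * b).
  apply: cvgM; last exact: cvg_cst.
  exact: is_cvg_series_exp_coeff.
apply/funext => n; rewrite /series /= big_distrl /=.
by apply: eq_bigr => k _; rewrite /exp_coeff /= exprMn; ring.
Qed.

(** Differentiation shifts the coefficients because [(k + 1) / (k + 1)!] is [1 / k!]. *)
Lemma is_derive_expsum a t : geometric_growth a ->
  is_derive t 1 (expsum a) (expsum (fun k => a k.+1) t).
Proof.
have P b x : pseries (fun k => b k / k`!%:R) x =
    series (fun k => x ^+ k / k`!%:R * b k).
  by rewrite /pseries; congr series; apply/funext => k /=; ring.
have E b : (fun x => limn (pseries (fun k => b k / k`!%:R) x)) = expsum b.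
  by apply/funext => x; rewrite P.
have D b :
    pseries_diffs (fun k => b k / k`!%:R) = fun k => b k.+1 / k`!%:R :> R.
  apply/funext => k; rewrite /pseries_diffs factS natrM.
  have : k.+1%:R != 0 :> R by rewrite pnatr_eq0.
  have : k`!%:R != 0 :> R by rewrite pnatr_eq0 -lt0n fact_gt0.
  by move=> ? ?; field; apply/andP.
have cvgp b x (hb : geometric_growth b) :
    cvgn (pseries (fun k => b k / k`!%:R) x).
  by rewrite P; exact: cvg_expsum.
move=> ha.
(* Termwise differentiation asks for convergence of the series and of its first two formal
   derivatives at a point beyond [|t|]; [|t| + 1] is one. *)
have := @pseries_snd_diffs R (fun k => a k / k`!%:R) (`|t| + 1) t.
rewrite (E a) !D (congr1 (@^~ t) (E (fun k => a k.+1))).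
apply.
- exact: (cvgp _ _ ha).
- exact: (cvgp _ _ (geometric_growthS ha)).
- exact: (cvgp _ _ (geometric_growthS (geometric_growthS ha))).
- by rewrite ltr_normr ltrDl ltr01.
Qed.

End ExponentialSeries.

Lemma expsumZ (R : realType) (b : R) (a : nat -> R) (t : R) :
  geometric_growth a -> b * expsum a t = expsum (fun k => b * a k) t.
Proof.
move=> ha; have := @expsum_sum R 'I_1 (fun=> b) (fun=> a) t (fun=> ha).
rewrite big_ord1 => ->; congr (expsum _ t).
by apply/funext => k; rewrite big_ord1.
Qed.

Lemma expsum0 (R : realType) (a : nat -> R) : expsum a 0 = a 0%N.
Proof.
(* With ratio 0 the geometric sequence is [a 0] followed by zeros, since [0 ^+ 0 = 1]; these are
   also the only terms that survive at time 0. *)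
have := expsum_geometric 0 (a 0%N) 1; rewrite mul0r expR0 mul1r => <-.
rewrite /expsum (_ : (fun k => 0 ^+ k / k`!%:R * a k) =
  fun k => 1 ^+ k / k`!%:R * (0 ^+ k * a 0%N)) //.
apply/funext => -[|k]; first by rewrite !expr0; ring.
by rewrite !expr0n /=; ring.
Qed.

(** * The semigroup of a kernel *)

Section Semigroup.
Context {R : realType} {X : finType} (M : X -> X -> R).
Implicit Types (g : X -> R) (t : R) (x y : X).

Definition kernel_pow (k : nat) x y : R :=
  (kernel_mx M ^+ k) (enum_rank x) (enum_rank y).

Definition evolve t g : X -> R := fun x => \sum_y semigroup M t x y * g y.

Lemma semigroupE t x y :
  semigroup M t x y = expsum (fun k => kernel_pow k x y) t.
Proof. by []. Qed.

Lemma kernel_pow0 x y : kernel_pow 0 x y = (x == y)%:R.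
Proof.
by rewrite /kernel_pow expr0 /GRing.one /= mxE (inj_eq enum_rank_inj).
Qed.

Lemma kernel_powS k x y :
  kernel_pow k.+1 x y = \sum_z M x z * kernel_pow k z y.
Proof.
rewrite /kernel_pow exprS -[_ * _]/(_ *m _) mxE.
rewrite (reindex (@enum_rank X)) /=; last first.
  by apply: onW_bij; exact: enum_rank_bij.
by apply: eq_bigr => z _; rewrite mxE !enum_rankK.
Qed.

Lemma kernel_powSr k x y :
  kernel_pow k.+1 x y = \sum_z kernel_pow k x z * M z y.
Proof.
rewrite /kernel_pow exprSr -[_ * _]/(_ *m _) mxE.
rewrite (reindex (@enum_rank X)) /=; last first.
  by apply: onW_bij; exact: enum_rank_bij.
by apply: eq_bigr => z _; rewrite [kernel_mx M _ _]mxE !enum_rankK.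
Qed.

(** The ratio is the sum of the absolute values of all entries: it dominates every row sum, so one
    induction serves all [x]. *)
Lemma kernel_pow_growth x y : geometric_growth (fun k => kernel_pow k x y).
Proof.
exists 1, (\sum_x' \sum_z `|M x' z|); split.
  by apply: sumr_ge0 => i _; apply: sumr_ge0.
move=> k; elim: k x => [|k IH] x.
  by rewrite kernel_pow0 expr0 mul1r; case: (x == y); rewrite ?normr1 ?normr0.
rewrite kernel_powS; apply: le_trans (ler_norm_sum _ _ _) _.
rewrite mul1r exprS.
apply: (@le_trans _ _ ((\sum_z `|M x z|) * (\sum_x' \sum_z `|M x' z|) ^+ k)).
  rewrite big_distrl /=; apply: ler_sum => z _.
  by rewrite normrM ler_wpM2l //; move: (IH z); rewrite mul1r.
rewrite ler_wpM2r ?exprn_ge0 //.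
  by apply: sumr_ge0 => i _; apply: sumr_ge0.
by rewrite [leRHS](bigD1 x) //= lerDl; apply: sumr_ge0 => i _; apply: sumr_ge0.
Qed.

Lemma evolveE t g x :
  evolve t g x = expsum (fun k => \sum_y kernel_pow k x y * g y) t.
Proof.
rewrite /evolve; under eq_bigr do rewrite mulrC semigroupE.
rewrite expsum_sum => [|y]; last exact: kernel_pow_growth.
by congr (expsum _ t); apply/funext => k; apply: eq_bigr => y _; rewrite mulrC.
Qed.

Lemma evolve0 g : evolve 0 g = g.
Proof.
apply/funext => x; rewrite evolveE expsum0 (bigD1 x) //= kernel_pow0 eqxx mul1r.
rewrite big1 ?addr0 // => y yx; rewrite kernel_pow0 eq_sym (negbTE yx) mul0r //.
Qed.

(** Induction gives [M^k g = s^k g], the powers being peeled on the right so that [M] meets [g]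
    first. *)
Lemma evolve_eigen (s t : R) g x :
  (forall x, \sum_y M x y * g y = s * g x) ->
  evolve t g x = expR (s * t) * g x.
Proof.
move=> sg; rewrite evolveE -expsum_geometric; congr (expsum _ t).
apply/funext; elim=> [|k IH].
  rewrite (bigD1 x) //= kernel_pow0 eqxx big1 ?addr0 ?expr0 // => y yx.
  by rewrite kernel_pow0 eq_sym (negbTE yx) mul0r.
under eq_bigr do rewrite kernel_powSr big_distrl /=.
rewrite exchange_big /=.
under eq_bigr => z _.
  under eq_bigr do rewrite -mulrA.
  rewrite -big_distrr /= sg mulrCA; over.
by rewrite -big_distrr /= IH mulrA exprS.
Qed.

(** The backward equation: the coefficient shift amounts to peeling one factor [M] off the left of
    the power. *)
Lemma is_derive_evolve t g x :
  is_derive t 1 (fun s => evolve s g x) (- neg_gen M (evolve t g) x).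
Proof.
have growth z : geometric_growth (fun k => \sum_y kernel_pow k z y * g y).
  rewrite (_ : (fun _ => _) = fun k => \sum_y g y * kernel_pow k z y).
    by apply: geometric_growth_sum => y; exact: kernel_pow_growth.
  by apply/funext => k; apply: eq_bigr => y _; rewrite mulrC.
rewrite (_ : (fun s => evolve s g x) =
    expsum (fun k => \sum_y kernel_pow k x y * g y)); last first.
  by apply/funext => s; rewrite evolveE.
apply: is_derive_eq; first exact: is_derive_expsum.
rewrite /neg_gen opprK; under [RHS]eq_bigr do rewrite evolveE.
rewrite expsum_sum //; congr (expsum _ t); apply/funext => k.
under eq_bigr do rewrite kernel_powS big_distrl /=.
rewrite exchange_big /=; apply: eq_bigr => z _.
by rewrite big_distrr /=; apply: eq_bigr => y _; rewrite mulrA.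
Qed.

(** Detailed balance passes to powers: one side is expanded from the left and the other from the
    right, [rev] carries [nu] across the single factor and the induction hypothesis across the
    rest. *)
Lemma semigroup_reversible (nu : X -> R) t x y :
  (forall x y, nu x * M x y = nu y * M y x) ->
  nu x * semigroup M t x y = nu y * semigroup M t y x.
Proof.
move=> rev; rewrite !semigroupE !expsumZ; try exact: kernel_pow_growth.
congr (expsum _ t); apply/funext => k.
elim: k x y => [|k IH] x y.
  by rewrite !kernel_pow0 eq_sym; case: eqP => [->|] //; rewrite !mulr0.
rewrite kernel_powS kernel_powSr !big_distrr /=; apply: eq_bigr => z _.
by rewrite mulrA rev mulrAC IH -mulrA.
Qed.

End Semigroup.

(** * Convergence of reversible chains *)

Lemma is_derive_sum_fin (R : realType) (I : finType) (h : I -> R -> R)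
    (dh : I -> R) (t : R) :
  (forall i, is_derive t (1 : R) (h i) (dh i)) ->
  is_derive t (1 : R) (fun s => \sum_i h i s) (\sum_i dh i).
Proof.
move=> hd; rewrite (_ : (fun _ => _) = \sum_i h i); last first.
  by apply/funext => s; rewrite fct_sumE.
elim/big_rec2: _ => [|i y1 y2 _ IH]; first exact: is_derive_cst.
exact: is_deriveD.
Qed.

Lemma le0_is_derive_nincr (R : realType) (F dF : R -> R) (t : R) :
  (forall s : R, is_derive s (1 : R) F (dF s)) -> (forall s, dF s <= 0) ->
  0 <= t -> F t <= F 0.
Proof.
move=> hF F0 t0; apply: (@ler0_derive1_nincr R F 0 t) => //.
- by move=> s _; have hs := hF s; rewrite derive1E derive_val.
- apply: continuous_subspaceT => s.
  by apply/differentiable_continuous/derivable1_diffP; case: (hF s).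
Qed.

Section ReversibleChain.
Context {R : realType} {X : finType}.
Variables (M : X -> X -> R) (nu : X -> R).
Hypothesis Mgen : generator M.
Hypothesis Mrev : forall x y, nu x * M x y = nu y * M y x.
Hypothesis nu_gt0 : forall x, 0 < nu x.
Hypothesis nu1 : \sum_x nu x = 1.
Implicit Types (g h : X -> R) (t : R) (x y : X).

Let A g : X -> R := neg_gen M g.
Let lambda : R := spectral_gap M nu.

Lemma inner_ge0 g : 0 <= inner nu g g.
Proof.
by apply: sumr_ge0 => x _; rewrite -expr2 mulr_ge0 ?sqr_ge0 // ltW.
Qed.

Lemma inner_eq0 g : inner nu g g = 0 -> g = fun=> 0.
Proof.
move=> /eqP; rewrite psumr_eq0; last first.
  by move=> x _; rewrite -expr2 mulr_ge0 ?sqr_ge0 // ltW.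
move=> /allP g0; apply/funext => x; have := g0 x (mem_index_enum _).
by rewrite /= mulf_eq0 (gt_eqF (nu_gt0 x)) orbF -expr2 sqrf_eq0 => /eqP.
Qed.

Lemma inner_gt0 g : g <> (fun=> 0) -> 0 < inner nu g g.
Proof.
move=> g0; rewrite lt_neqAle inner_ge0 andbT eq_sym.
by apply/eqP => /inner_eq0.
Qed.

Lemma inner_neg_gen_sym g h : inner nu (A g) h = inner nu (A h) g.
Proof.
rewrite /inner /A /neg_gen.
transitivity (- \sum_x \sum_y nu x * M x y * g y * h x).
  rewrite -sumrN; apply: eq_bigr => x _.
  rewrite mulNr mulNr; congr (- _).
  by rewrite !big_distrl /=; apply: eq_bigr => y _; ring.
rewrite exchange_big /= -sumrN; apply: eq_bigr => x _.
rewrite mulNr mulNr; congr (- _).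
by rewrite !big_distrl /=; apply: eq_bigr => y _; rewrite Mrev; ring.
Qed.

Lemma mean_neg_gen g : mean nu (A g) = 0.
Proof.
have -> : mean nu (A g) = inner nu (A g) (fun=> 1).
  by apply: eq_bigr => x _; rewrite mulr1.
rewrite inner_neg_gen_sym; apply: big1 => x _; rewrite /A /neg_gen.
by under eq_bigr do rewrite mulr1; rewrite Mgen.2 oppr0 !mul0r.
Qed.

(** On expanding the square, both pure square terms vanish: rows of [M] sum to zero, and detailed
    balance turns the second term into the first. The resulting sum over jumps is visibly
    nonnegative. *)
Lemma dirichletE g : inner nu (A g) g =
  2^-1 * \sum_x \sum_y nu x * M x y * (g x - g y) ^+ 2.
Proof.
have S1 : \sum_x \sum_y nu x * M x y * g x ^+ 2 = 0.
  apply: big1 => x _; rewrite -big_distrl /= -big_distrr /= Mgen.2.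
  by rewrite mulr0 mul0r.
have S2 : \sum_x \sum_y nu x * M x y * g y ^+ 2 = 0.
  rewrite exchange_big /= -[RHS]S1; apply: eq_bigr => x _.
  by apply: eq_bigr => y _; rewrite Mrev.
have -> : inner nu (A g) g = - \sum_x \sum_y nu x * M x y * (g x * g y).
  rewrite /inner /A /neg_gen -sumrN; apply: eq_bigr => x _.
  rewrite mulNr mulNr; congr (- _).
  by rewrite !big_distrl /=; apply: eq_bigr => y _; ring.
have -> : \sum_x \sum_y nu x * M x y * (g x - g y) ^+ 2 =
    \sum_x \sum_y nu x * M x y * g x ^+ 2
    + \sum_x \sum_y nu x * M x y * g y ^+ 2
    - 2 * \sum_x \sum_y nu x * M x y * (g x * g y).
  rewrite big_distrr /= -big_split -sumrB /=; apply: eq_bigr => x _.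
  rewrite big_distrr /= -big_split -sumrB /=; apply: eq_bigr => y _.
  by ring.
by rewrite S1 S2; lra.
Qed.

Lemma dirichlet_ge0 g : 0 <= inner nu (A g) g.
Proof.
rewrite dirichletE mulr_ge0 ?invr_ge0 //.
apply: sumr_ge0 => x _; apply: sumr_ge0 => y _.
have [->|xy] := eqVneq x y; first by rewrite subrr expr0n mulr0.
rewrite mulr_ge0 ?sqr_ge0 // mulr_ge0 //; first exact: ltW.
exact: Mgen.1.
Qed.

(** Nonnegativity of the form bounds the Rayleigh quotients below, so their infimum is a genuine
    lower bound. The zero function has no quotient and is treated apart. *)
Lemma spectral_gap_le g : mean nu g = 0 ->
  lambda * inner nu g g <= inner nu (A g) g.
Proof.
move=> g0; have [->|/eqP gn0] := eqVneq g (fun=> 0).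
  rewrite {1}/inner big1 ?mulr0; first exact: dirichlet_ge0.
  by move=> x _; rewrite !mul0r.
rewrite -ler_pdivlMr ?inner_gt0 //; apply: ge_inf; last by exists g.
by exists 0 => _ [h _ <-]; rewrite divr_ge0 ?dirichlet_ge0 ?inner_ge0.
Qed.

Lemma sum_semigroup t x : \sum_y semigroup M t x y = 1.
Proof.
have -> : \sum_y semigroup M t x y = evolve M t (fun=> 1) x.
  by apply: eq_bigr => y _; rewrite mulr1.
rewrite (@evolve_eigen R X M 0 t (fun=> 1)).
  by rewrite mul0r expR0 mul1r.
by move=> z; under eq_bigr do rewrite mulr1; rewrite Mgen.2 mul0r.
Qed.

(** Stationarity of [nu], from reversibility and the unit row sums of the semigroup. *)
Lemma mean_evolve t g : mean nu (evolve M t g) = mean nu g.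
Proof.
rewrite /mean /evolve; under eq_bigr do rewrite big_distrl /=.
rewrite exchange_big /=; apply: eq_bigr => y _.
rewrite -[RHS]mulr1 -(sum_semigroup t y) big_distrr /=; apply: eq_bigr => x _.
by rewrite mulrC mulrA (semigroup_reversible t x y Mrev); ring.
Qed.

Lemma evolve_decay t g : 0 <= t -> mean nu g = 0 ->
  inner nu (evolve M t g) (evolve M t g)
  <= expR (- lambda * t) ^+ 2 * inner nu g g.
Proof.
move=> t0 g0.
pose u s := evolve M s g.
pose F s := expR (2 * lambda * s) * inner nu (u s) (u s).
pose dF s := 2 * expR (2 * lambda * s) *
  (lambda * inner nu (u s) (u s) - inner nu (A (u s)) (u s)).
have : F t <= F 0.
  apply: (@le0_is_derive_nincr R F dF) => // s; last first.
    rewrite /dF mulr_ge0_le0 ?mulr_ge0 ?expR_ge0 // subr_le0.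
    (* The mean stays zero along the evolution, so the gap inequality is available at every time
       [s]. *)
    by apply: spectral_gap_le; rewrite mean_evolve.
  have du x : is_derive s (1 : R) (fun r => u r x) (- A (u s) x).
    exact: is_derive_evolve.
  have de : is_derive s (1 : R) (fun r => expR (2 * lambda * r))
      (expR (2 * lambda * s) * (2 * lambda)).
    apply: (@is_derive1_comp R expR (fun r => 2 * lambda * r)).
    have := is_deriveZ (2 * lambda) (is_derive_id s (1 : R)).
    by move=> /is_derive_eq; apply; rewrite /GRing.scale /= mulr1.
  have di : is_derive s (1 : R) (fun r => inner nu (u r) (u r))
      (\sum_x (- A (u s) x * u s x * nu x *+ 2)).
    apply: is_derive_sum_fin => x.
    have := is_deriveM (is_deriveM (du x) (du x)) (is_derive_cst (nu x) s 1).
    by move=> /is_derive_eq; apply; rewrite /GRing.scale /= ?fctE; ring.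
  have := is_deriveM de di; move=> /is_derive_eq; apply.
  rewrite /GRing.scale /= /dF sumrMnl.
  have -> : \sum_x (- A (u s) x * u s x * nu x) = - inner nu (A (u s)) (u s).
    by rewrite -sumrN; apply: eq_bigr => x _; ring.
  by ring.
rewrite /F /u evolve0 mulr0 expR0 mul1r.
move=> /(ler_wpM2l (sqr_ge0 (expR (- lambda * t)))); rewrite mulrA.
rewrite (_ : _ ^+ 2 * expR (2 * lambda * t) = 1) ?mul1r // expr2 -!expRD.
by rewrite -[RHS]expR0; congr expR; ring.
Qed.

Lemma tv_upper t x : 0 <= t ->
  tv_dist (semigroup M t x) nu <= (nu x)^-1 / 2 * expR (- lambda * t).
Proof.
move=> t0; pose h0 y := (y == x)%:R / nu x - 1.
have nux : nu x != 0 by rewrite gt_eqF.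
have h00 : mean nu h0 = 0.
  rewrite /mean /h0; under eq_bigr do rewrite mulrBl mul1r.
  rewrite sumrB nu1 (bigD1 x) //= eqxx big1 ?addr0; last first.
    by move=> y /negbTE ->; rewrite !mul0r.
  by rewrite mul1r mulVf // subrr.
(* The squared norm is exactly [1 / nu x - 1]; [z - 1 <= z ^+ 2] bounds it by a square, so that the
   constant becomes [1 / nu x]. *)
have h0h0 : inner nu h0 h0 <= (nu x)^-1 ^+ 2.
  have -> : inner nu h0 h0 = (nu x)^-1 - 1.
    have -> : inner nu h0 h0 =
        \sum_y h0 y * ((y == x)%:R / nu x * nu y) - mean nu h0.
      rewrite /mean -sumrB; apply: eq_bigr => y _.
      by rewrite /h0; ring.
    rewrite h00 subr0 (bigD1 x) //= big1 ?addr0; last first.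
      by move=> y /negbTE ->; rewrite !mul0r mulr0.
    by rewrite /h0 eqxx mulr1n; field.
  rewrite -subr_ge0; have : 0 <= ((nu x)^-1 - 1) ^+ 2 by exact: sqr_ge0.
  have : 0 < (nu x)^-1 by rewrite invr_gt0.
  by nra.
pose h := evolve M t h0.
(* Reversibility trades [semigroup M t y x / nu x] for [semigroup M t x y / nu y], which makes [h]
   the relative density of the law at time [t] minus 1. *)
have hE y : h y * nu y = semigroup M t x y - nu y.
  rewrite /h /evolve /h0; under eq_bigr do rewrite mulrBr mulr1.
  rewrite sumrB sum_semigroup (bigD1 x) //= eqxx big1 ?addr0; last first.
    by move=> z /negbTE ->; rewrite !mul0r mulr0.
  have := semigroup_reversible t x y Mrev => e.
  rewrite mulrBl; congr (_ - _); last exact: mul1r.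
  by apply: (mulfI nux); rewrite e mulr1n; field.
pose s : R := \sum_y `|h y| * nu y.
have -> : tv_dist (semigroup M t x) nu = 2^-1 * s.
  congr (_ * _); apply: eq_bigr => y _.
  by rewrite -hE normrM (gtr0_norm (nu_gt0 y)).
have s0 : 0 <= s by apply: sumr_ge0 => y _; rewrite mulr_ge0 // ltW.
have sE : \sum_y `|h y| * nu y = s by []; clearbody s.
(* Jensen: the variance of [`|h|] under [nu] is nonnegative. *)
have jensen : s ^+ 2 <= inner nu h h.
  rewrite -subr_ge0.
  have -> : inner nu h h - s ^+ 2 = \sum_y (`|h y| - s) ^+ 2 * nu y.
    transitivity (inner nu h h - 2 * s * (\sum_y `|h y| * nu y)
        + s ^+ 2 * \sum_y nu y).
      by rewrite nu1 sE; ring.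
    rewrite /inner !big_distrr /= -sumrB -big_split /=.
    apply: eq_bigr => y _.
    by rewrite -expr2 -(real_normK (num_real (h y))); ring.
  by apply: sumr_ge0 => y _; rewrite mulr_ge0 ?sqr_ge0 // ltW.
have : s <= expR (- lambda * t) * (nu x)^-1.
  rewrite -(@ler_pXn2r _ 2) ?nnegrE //; last first.
    by rewrite mulr_ge0 ?expR_ge0 // invr_ge0 ltW.
  apply: (le_trans jensen); apply: (le_trans (evolve_decay t0 h00)).
  by rewrite exprMn ler_wpM2l ?sqr_ge0.
rewrite /lambda; lra.
Qed.

(** * The eigenfunction at the spectral gap and the lower bound *)

(** A second state guarantees a nonzero mean-zero function; otherwise the infimum would range over
    the empty set. *)
Lemma gap_eigenfunction : (1 < #|X|)%N ->
  exists g, g <> (fun=> 0) /\ mean nu g = 0 /\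
    forall x, \sum_y M x y * g y = - lambda * g x.
Proof.
move=> X2.
have [a [b ab]] : exists a b : X, a != b.
  by move/card_gt1P: X2 => [a [b [_ _ ab]]]; exists a, b.
(* Functions are transported to row vectors, where the compactness and extreme value theorems
   apply. *)
pose fn (v : 'rV[R]_#|X|) : X -> R := fun x => v ord0 (enum_rank x).
pose rv (g : X -> R) : 'rV[R]_#|X| := \row_i g (enum_val i).
have rvK g : fn (rv g) = g.
  by apply/funext => x; rewrite /fn mxE enum_rankK.
have cont_fn x : continuous (fun v => fn v x) by exact: coord_continuous.
have cont_sum (F : X -> 'rV[R]_#|X| -> R) :
    (forall x, continuous (F x)) -> continuous (fun v => \sum_x F x v).
  move=> cF v; have Fv : Filter (nbhs v) by exact: nbhs_filter.
  by apply: (cvg_big add_continuous) => x _; exact: cF.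
have cont_mul (F G : 'rV[R]_#|X| -> R) : continuous F -> continuous G ->
    continuous (fun v => F v * G v).
  by move=> cF cG v; exact: cvgM (cF v) (cG v).
have cont_c (r : R) : continuous (fun _ : 'rV[R]_#|X| => r).
  exact: cst_continuous.
have cont_neg x : continuous (fun v => A (fn v) x).
  have c : continuous (fun v => \sum_y M x y * fn v y).
    by apply: cont_sum => y; apply: cont_mul.
  by move=> v; exact: (cvgN (c v)).
have cont_inner : continuous (fun v => inner nu (fn v) (fn v)).
  apply: cont_sum => x.
  apply: (cont_mul (fun v => fn v x * fn v x)); last exact: cont_c.
  by apply: cont_mul; exact: cont_fn.
have cont_mean : continuous (fun v => mean nu (fn v)).
  by apply: cont_sum => x; apply: cont_mul; [exact: cont_fn | exact: cont_c].
have cont_dirichlet : continuous (fun v => inner nu (A (fn v)) (fn v)).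
  apply: cont_sum => x.
  apply: (cont_mul (fun v => A (fn v) x * fn v x)); last exact: cont_c.
  by apply: cont_mul; [exact: cont_neg | exact: cont_fn].
(* Unit norm gives [g x ^+ 2 <= 1 / nu x]; the cruder radius [1 + 1 / nu x] avoids a square root. *)
pose box := [set v : 'rV[R]_#|X| |
  forall i, [set` `[- (1 + (nu (enum_val i))^-1), 1 + (nu (enum_val i))^-1]]
    (v ord0 i)].
pose S := [set v | inner nu (fn v) (fn v) = 1] `&` [set v | mean nu (fn v) = 0].
have boxS : S `<=` box.
  move=> v [v1 _] i /=; rewrite in_itv /= -ler_norml.
  have vi : `|v ord0 i| ^+ 2 * nu (enum_val i) <= 1.
    rewrite -v1 /inner (bigD1 (enum_val i)) //= real_normK ?num_real //.
    rewrite /fn enum_valK -expr2 lerDl; apply: sumr_ge0 => x _.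
    by rewrite -expr2 mulr_ge0 ?sqr_ge0 // ltW.
  rewrite leNgt; apply/negP => lt.
  have := nu_gt0 (enum_val i); move: vi lt.
  set n := nu _; set w := `|_| => vi lt n0.
  have : n^-1 * n = 1 by rewrite mulVf // gt_eqF.
  have : 0 < n^-1 by rewrite invr_gt0.
  move: lt; set m := n^-1 => lt m0 mn.
  have : m < w ^+ 2 by nra.
  nra.
have cS : compact S.
  apply: (subclosed_compact _ _ boxS).
    apply: closedI.
      apply: (@closed_comp _ _ (fun v => inner nu (fn v) (fn v)) [set 1]).
        by move=> v _; exact: cont_inner.
      exact: closed_eq.
    apply: (@closed_comp _ _ (fun v => mean nu (fn v)) [set 0]).
      by move=> v _; exact: cont_mean.
    exact: closed_eq.
  apply: (@rV_compact R _ (fun i =>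
    [set` `[- (1 + (nu (enum_val i))^-1), 1 + (nu (enum_val i))^-1]])) => i.
  exact: segment_compact.
(* The Rayleigh quotient is invariant under scaling, so each of its values is a value of the form on
   the unit sphere [S]. *)
have normalize g : g <> (fun=> 0) -> mean nu g = 0 ->
    exists2 v, S v & inner nu (A (fn v)) (fn v) =
                     inner nu (A g) g / inner nu g g.
  move=> gn0 g0; have gg := inner_gt0 gn0.
  pose r := (Num.sqrt (inner nu g g))^-1.
  have rr : r ^+ 2 = (inner nu g g)^-1.
    by rewrite exprVn sqr_sqrtr // ltW.
  exists (rv (fun x => r * g x)).
    split; rewrite /= rvK.
      transitivity (r ^+ 2 * inner nu g g); last by rewrite rr mulVf ?gt_eqF.
      by rewrite /inner big_distrr /=; apply: eq_bigr => x _; ring.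
    transitivity (r * mean nu g); last by rewrite g0 mulr0.
    by rewrite /mean big_distrr /=; apply: eq_bigr => x _; ring.
  rewrite rvK [RHS]mulrC -rr /inner big_distrr /=; apply: eq_bigr => x _.
  rewrite /A /neg_gen.
  have -> : \sum_y M x y * (r * g y) = r * \sum_y M x y * g y.
    by rewrite big_distrr /=; apply: eq_bigr => y _; ring.
  by ring.
(* This mean-zero function shows that both [S] and the set of Rayleigh quotients are nonempty. *)
pose g0 x := (x == a)%:R / nu a - (x == b)%:R / nu b.
have g0n0 : g0 <> (fun=> 0).
  move=> /(congr1 (@^~ a)); rewrite /g0 eqxx (negbTE ab) mul0r subr0 mul1r.
  by move/eqP; rewrite invr_eq0 gt_eqF.
have g0m : mean nu g0 = 0.
  rewrite /mean /g0; under eq_bigr do rewrite mulrBl.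
  rewrite sumrB (bigD1 a) //= eqxx big1 => [|x /negbTE ->]; last first.
    by rewrite !mul0r.
  rewrite (bigD1 b) //= eqxx big1 => [|x /negbTE ->]; last by rewrite !mul0r.
  by rewrite !mul1r !mulVf ?gt_eqF // !addr0 subrr.
have [v Sv vmin] : exists2 v, v \in S & forall w, w \in S ->
    inner nu (A (fn v)) (fn v) <= inner nu (A (fn w)) (fn w).
  apply: (@EVT_min_rV R _ (fun v => inner nu (A (fn v)) (fn v)) S) => //.
    by have [v Sv _] := normalize _ g0n0 g0m; exists v.
  exact: continuous_subspaceT.
set g := fn v in vmin.
move: Sv; rewrite inE => -[/= g1 gm].
have gn0 : g <> (fun=> 0).
  move=> e; move: g1; rewrite -/g e /inner big1 => [/eqP|x _].
    by rewrite eq_sym oner_eq0.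
  by rewrite !mul0r.
have Ag : inner nu (A g) g <= lambda.
  apply: lb_le_inf.
    by exists (inner nu (A g0) g0 / inner nu g0 g0), g0.
  move=> _ [h [hn0 h0] <-]; have [w Sw <-] := normalize _ hn0 h0.
  by apply: vmin; rewrite inE.
exists g; split=> //; split=> //.
(* The residual of the eigenvalue equation. It has mean zero, so [g + s h] remains an admissible
   competitor. *)
pose h x := A g x - lambda * g x.
have hm : mean nu h = 0.
  transitivity (mean nu (A g) - lambda * mean nu g).
    rewrite /mean big_distrr /= -sumrB; apply: eq_bigr => x _.
    by rewrite /h; ring.
  by rewrite mean_neg_gen gm mulr0 subr0.
(* The quadratic form [-M - lambda] is nonnegative on mean-zero functions and
   vanishes at [g]; expanding it at [g + s h] forces the linear term in [s],
   which is [2 * inner nu h h] because [h = (-M - lambda) g], to vanish. *)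
have variation s : 0 <= 2 * s * inner nu h h
    + s ^+ 2 * (inner nu (A h) h - lambda * inner nu h h).
  have : mean nu (fun x => g x + s * h x) = 0.
    transitivity (mean nu g + s * mean nu h).
      by rewrite /mean big_distrr /= -big_split; apply: eq_bigr => x _ /=; ring.
    by rewrite gm hm mulr0 addr0.
  move/spectral_gap_le.
  have Alin x : A (fun x => g x + s * h x) x = A g x + s * A h x.
    rewrite /A /neg_gen mulrN -opprD; congr (- _).
    by rewrite big_distrr -big_split /=; apply: eq_bigr => y _; ring.
  have bil p1 p2 q1 q2 : inner nu (fun x => p1 x + s * p2 x)
      (fun x => q1 x + s * q2 x) = inner nu p1 q1 + s * inner nu p1 q2
      + s * inner nu p2 q1 + s ^+ 2 * inner nu p2 q2.
    rewrite /inner !big_distrr -!big_split /=.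
    by apply: eq_bigr => x _; ring.
  rewrite (_ : A _ = fun x => A g x + s * A h x); last by apply/funext.
  rewrite !bil (inner_neg_gen_sym h g).
  have -> : inner nu h g = inner nu g h by apply: eq_bigr => x _; ring.
  have hh : inner nu h h = inner nu (A g) h - lambda * inner nu g h.
    rewrite /inner big_distrr -sumrB /=; apply: eq_bigr => x _.
    by rewrite {1}/h; ring.
  by rewrite g1; nra.
have : h = fun=> 0.
  apply: inner_eq0; move: variation (inner_ge0 h).
  set B := inner nu h h; set C := _ - _ => var B0.
  have := ler_norm C; have := normr_ge0 C; set c := `|C| => c0 Cc.
  (* Here [c] is [|C|]. With [d = B / (c + 1)], taking [s = - d] bounds the variation above by
     [- d ^+ 2 * (c + 2)], which forces [d = 0] and hence [B = 0]. *)
  have := var (- (B / (c + 1))).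
  have : B / (c + 1) * (c + 1) = B by rewrite mulfVK // gt_eqF // ltr_wpDl.
  have : 0 <= B / (c + 1) by rewrite divr_ge0 // addr_ge0.
  set d := B / _ => d0 dc vd.
  have dC : d ^+ 2 * C <= d ^+ 2 * c by rewrite ler_wpM2l ?sqr_ge0.
  have d2 : d ^+ 2 * (c + 2) <= 0 by move: vd; rewrite -dc; nra.
  suff dz : d = 0 by rewrite -dc dz mul0r.
  apply/eqP; rewrite -sqrf_eq0 eq_le sqr_ge0 andbT.
  by rewrite -(pmulr_lle0 _ (_ : 0 < c + 2)) // ltr_wpDl.
move=> h0 x; have /eqP := congr1 (@^~ x) h0.
rewrite /h subr_eq0 => /eqP; rewrite /A /neg_gen => e.
by rewrite mulNr -e opprK.
Qed.

Lemma tv_lower t : (1 < #|X|)%N ->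
  exists x, 2^-1 * expR (- lambda * t) <= tv_dist (semigroup M t x) nu.
Proof.
move=> /gap_eigenfunction [g [gn0 [gm geig]]].
have [y0 gy0] : exists y, g y != 0.
  apply: contra_notP gn0 => /forallNP g0; apply/funext => x.
  by have /negP := g0 x; rewrite negbK => /eqP.
(* The starting state is chosen without reference to [t]; maximality lets every [|g y|] be replaced
   by [|g x|] in the final sum. *)
pose x := [arg max_(i > y0) `|g i|]%O.
have xmax y : `|g y| <= `|g x|.
  by rewrite /x; case: arg_maxP => // i _ /(_ y); apply.
exists x.
have gx : 0 < `|g x| by apply: lt_le_trans (xmax y0); rewrite normr_gt0.
rewrite /tv_dist ler_pM2l ?invr_gt0 // -(ler_pM2r gx).
(* Subtracting [mean nu g], which is zero, brings out the difference of the two measures integrated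
   against [g]. *)
have -> : expR (- lambda * t) * `|g x| = `|evolve M t g x - mean nu g|.
  by rewrite gm subr0 (evolve_eigen _ _ geig) normrM gtr0_norm ?expR_gt0.
rewrite /evolve /mean -sumrB; apply: le_trans (ler_norm_sum _ _ _) _.
rewrite big_distrl /=; apply: ler_sum => y _.
rewrite (_ : _ - _ = (semigroup M t x y - nu y) * g y); last by ring.
by rewrite normrM ler_wpM2l.
Qed.

End ReversibleChain.

(** * Gibbs measures and the modified energy *)

Section Gibbs.
Context {R : realType} {X : finType}.
Implicit Types (U V : X -> R) (Q : X -> X -> R).

Lemma partition_gt0 U (x : X) : 0 < \sum_y expR (- U y).
Proof.
rewrite (bigD1 x) //= ltr_pwDl ?expR_gt0 //.
by apply: sumr_ge0 => y _; exact: expR_ge0.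
Qed.

Lemma gibbs_gt0 U x : 0 < gibbs U x.
Proof. by rewrite divr_gt0 ?expR_gt0 ?(partition_gt0 U x). Qed.

Lemma sum_gibbs U (x : X) : \sum_y gibbs U y = 1.
Proof. by rewrite -big_distrl /= divff // gt_eqF ?(partition_gt0 U x). Qed.

(** Allows [H] to be replaced by [H - Hmin H], the energy to which the modified one is
    comparable. *)
Lemma gibbs_shift U (b : R) : gibbs (fun x => U x - b) = gibbs U.
Proof.
apply/funext => x; have S := partition_gt0 U x.
have E y : expR (- (U y - b)) = expR b * expR (- U y).
  by rewrite -expRD; congr expR; ring.
rewrite /gibbs E; under eq_bigr do rewrite E.
by rewrite -big_distrr /= -mulf_div divff ?mul1r // gt_eqF // expR_gt0.
Qed.

(** The partition function is at most [#|X|] since [U] is nonnegative, and each weight is at least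
    [expR (- L)]. This is the source of the constant in the upper bound. *)
Lemma gibbs_inv_le U (L : R) x : (forall y, 0 <= U y <= L) ->
  (gibbs U x)^-1 <= expR L * #|X|%:R.
Proof.
move=> UL; rewrite /gibbs invf_div -expRN opprK.
rewrite mulrC ler_pM ?expR_ge0 //.
- by rewrite ltW // (partition_gt0 U x).
- by rewrite ler_expR; case/andP: (UL x).
- rewrite -sum1_card natr_sum; apply: ler_sum => y _.
  by rewrite -expR0 ler_expR oppr_le0; case/andP: (UL y).
Qed.

Lemma generator_metropolis Q U : generator Q -> generator (metropolis Q U).
Proof.
move=> [Q0 _]; split=> [x y xy|x]; rewrite /metropolis.
  by rewrite (negbTE xy) mulr_ge0 ?expR_ge0 ?Q0.
rewrite (bigD1 x) //= eqxx addrC; apply/eqP; rewrite subr_eq0; apply/eqP.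
by apply: eq_bigr => y /negbTE yx; rewrite eq_sym yx.
Qed.

(** For distinct states both sides equal [Q x y * expR (- Num.max (U x) (U y))] divided by the
    partition function. *)
Lemma metropolis_reversible Q U : symmetric_kernel Q ->
  forall x y, gibbs U x * metropolis Q U x y = gibbs U y * metropolis Q U y x.
Proof.
move=> Qs x y; have [->//|xy] := eqVneq x y.
rewrite /metropolis (negbTE xy) eq_sym (negbTE xy) /gibbs (Qs y x).
have E a b : expR (- U a) * expR (- Num.max (U b - U a) 0) =
    expR (- Num.max (U a) (U b)).
  rewrite -expRD; congr expR; rewrite -opprD addr_maxr addr0 maxC.
  by rewrite addrC subrK.
transitivity (Q x y / (\sum_z expR (- U z)) *
    (expR (- U x) * expR (- Num.max (U y - U x) 0))); first by ring.
by rewrite E maxC -E; ring.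
Qed.

(* Lowering the energy by at most [d] raises each unnormalised weight by at
   most [d], because [exp] is 1-Lipschitz on the nonpositive half-line. *)
Lemma tv_gibbs_le U V (L d : R) : (forall x, 0 <= U x) ->
  (forall x, U x <= V x <= L) -> (forall x, V x - U x <= d) -> 0 <= d ->
  tv_dist (gibbs U) (gibbs V) <= expR L * d.
Proof.
move=> U0 UV UVd d0.
have [x _|X0] := pickP X; last first.
  rewrite /tv_dist big1 ?mulr0 ?mulr_ge0 ?expR_ge0 // => x _.
  by have := X0 x.
pose a y := expR (- U y); pose b y := expR (- V y).
pose Za := \sum_y a y; pose Zb := \sum_y b y.
have Za0 : 0 < Za := partition_gt0 U x.
have Zb0 : 0 < Zb := partition_gt0 V x.
have ba y : b y <= a y by rewrite ler_expR lerN2; case/andP: (UV y).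
have abd y : a y - b y <= d.
  have := expR_ge1Dx (U y - V y).
  have -> : b y = a y * expR (U y - V y).
    by rewrite -expRD; congr expR; ring.
  have a1 : a y <= 1 by rewrite -expR0 ler_expR oppr_le0.
  have a0 : 0 <= a y by exact: expR_ge0.
  have := UVd y; have /andP[] := UV y.
  by set e := expR (U y - V y); nra.
have bZ : Zb <= Za by apply: ler_sum.
have Zd : Za - Zb <= #|X|%:R * d.
  rewrite -sumrB -sum1_card natr_sum big_distrl /=.
  by apply: ler_sum => y _; rewrite mul1r.
(* Since [U <= L], every weight is at least [expR (- L)]; this absorbs the factor [#|X|] of [Zd]
   after division by [Za]. *)
have ZL : #|X|%:R <= Za * expR L.
  rewrite -sum1_card natr_sum big_distrl /=; apply: ler_sum => y _.
  rewrite -expRD -expR0 ler_expR addrC subr_ge0.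
  by case/andP: (UV y) => le1; exact: le_trans.
have -> : tv_dist (gibbs U) (gibbs V) = 2^-1 * \sum_y `|a y / Za - b y / Zb|.
  by [].
(* One part changes the weights and the other the normalisation. Each sums to [(Za - Zb) / Za], and
   the two copies cancel the factor 1/2 of [tv_dist]. *)
have le y : `|a y / Za - b y / Zb| <=
    (a y - b y) / Za + b y / Zb * ((Za - Zb) / Za).
  have -> : a y / Za - b y / Zb =
      (a y - b y) / Za - b y / Zb * ((Za - Zb) / Za).
    by field; rewrite !gt_eqF.
  apply: le_trans (ler_normB _ _) _; rewrite !ger0_norm //.
    by rewrite !mulr_ge0 ?invr_ge0 ?subr_ge0 ?expR_ge0 ?(ltW Za0) ?(ltW Zb0).
  by rewrite mulr_ge0 ?invr_ge0 ?subr_ge0 ?(ltW Za0).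
have : \sum_y `|a y / Za - b y / Zb| <= 2 * ((Za - Zb) / Za).
  apply: le_trans (ler_sum _ (fun y _ => le y)) _.
  rewrite big_split /= -!big_distrl /= sumrB -/Za -/Zb divff ?gt_eqF //.
  by rewrite mul1r -mulr2n mulr_natl.
have : (Za - Zb) / Za <= expR L * d.
  rewrite ler_pdivrMr //; apply: (le_trans Zd).
  by rewrite mulrAC ler_wpM2r // mulrC.
by lra.
Qed.

Lemma Hmin_le U x : Hmin U <= U x.
Proof.
apply: ge_inf; last by exists x.
exists (- \sum_y `|U y|) => _ [y _ <-].
rewrite lerNl; apply: (@le_trans _ _ `|U y|); first by rewrite -normrN ler_norm.
by rewrite (bigD1 y) //= lerDl; apply: sumr_ge0.
Qed.

Lemma le_Hmax U x : U x <= Hmax U.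
Proof.
apply: ub_le_sup; last by exists x.
exists (\sum_y `|U y|) => _ [y _ <-]; apply: (le_trans (ler_norm _)).
by rewrite (bigD1 y) //= lerDl; apply: sumr_ge0.
Qed.

End Gibbs.

(** * Comparison of the modified and the original energy *)

(** Monotonicity supplies measurability and the bounds supply integrability, so no continuity of the
    integrand enters. *)
Lemma Rintegral_itv_bounds (R : realType) (g : R -> R) (a b m n : R) :
  a <= b -> {homo g : x y /~ y <= x} ->
  (forall x, a <= x <= b -> m <= g x <= n) ->
  m * (b - a) <= Rintegral lebesgue_measure `[a, b] g <= n * (b - a).
Proof.
move=> ab gmono gmn.
have len : fine (lebesgue_measure `[a, b]) = b - a.
  rewrite lebesgue_measure_itv /=; case: ltP => //=.
  by rewrite lee_fin => ba; apply/eqP; rewrite eq_sym subr_eq0 eq_le ab ba.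
have fin : (lebesgue_measure `[a, b] < +oo)%E.
  by rewrite lebesgue_measure_itv /=; case: ifP => _; exact: ltry.
(* Stated for a general [h] so as to cover the constants [m] and [n] as well as [g]. *)
have int h : {homo h : x y /~ y <= x} ->
    (forall x, a <= x <= b -> m <= h x <= n) ->
    lebesgue_measure.-integrable `[a, b] (EFin \o h).
  move=> hmono hmn; apply: measurable_bounded_integrable => //.
    exact: measurable_realfun.nonincreasing_measurable.
  exists (`|m| + `|n|); split=> [|r mnr x /=]; first exact: num_real.
  rewrite in_itv /= => /hmn /andP[mh hn]; apply: (le_trans _ (ltW mnr)).
  rewrite ler_norml; have := ler_norm n; have := ler_norm (- m).
  by rewrite normrN; have := normr_ge0 m; have := normr_ge0 n; lra.
have mn : m <= n.
  by have := gmn a; rewrite lexx ab => /(_ isT)/andP[]; exact: le_trans.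
by apply/andP; split; rewrite -len -Rintegral_cst //; apply: le_Rintegral => //;
  try (by apply: int => // x _; rewrite ?lexx ?mn);
  move=> x /=; rewrite in_itv /= => /gmn /andP[].
Qed.

Section Landscape.
Context {R : realType} {X : finType}.
Variables (H : X -> R) (f : R -> R) (alpha c : R).
Hypothesis hf : admissible_penalty f.
Hypothesis hc : Hmin H <= c <= Hmax H.
Hypothesis alpha_gt0 : 0 < alpha.

(** The integrand lies between [1 - alpha * f (Hmax H - c)] and 1. The lower factor can be negative
    for large [alpha], so nonnegativity is recorded separately. *)
Lemma modified_H_bounds x :
  0 <= modified_H f alpha c H x /\
  (1 - alpha * f (Hmax H - c)) * (H x - Hmin H)
    <= modified_H f alpha c H x <= H x - Hmin H.
Proof.
have [_ f_ge0 f_mono _] := hf.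
have f0 u : 0 <= alpha * f (Num.max (u - c) 0).
  by rewrite mulr_ge0 ?(ltW alpha_gt0) // f_ge0 // le_max lexx orbT.
have den u : 0 < alpha * f (Num.max (u - c) 0) + 1 by rewrite ltr_wpDl.
split.
  by apply: Rintegral_ge0 => u _; rewrite invr_ge0 ltW.
rewrite -[X in _ && (_ <= X)]mul1r.
apply: Rintegral_itv_bounds; first exact: Hmin_le.
  move=> u v uv /=; rewrite lef_pV2 ?posrE // lerD2r.
  rewrite ler_wpM2l ?(ltW alpha_gt0) //.
  apply: f_mono; first by rewrite le_max lexx orbT.
  by rewrite ge_max !le_max lerB // lexx orbT.
move=> u /andP[_ uH]; apply/andP; split; last first.
  by rewrite invf_le1 // lerDr.
have le : f (Num.max (u - c) 0) <= f (Hmax H - c).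
  apply: f_mono; first by rewrite le_max lexx orbT.
  rewrite ge_max subr_ge0 (andP hc).2 andbT lerB //.
  exact: le_trans uH (le_Hmax H x).
have := f0 u; have : alpha * f (Num.max (u - c) 0) <= alpha * f (Hmax H - c).
  by rewrite ler_wpM2l // ltW.
set z := alpha * _; set w := alpha * _ => zw z0.
(* What remains is [(1 - w) * (z + 1) <= 1], which follows from [0 <= z <= w]. *)
rewrite -[leRHS]mul1r ler_pdivlMr ?ltr_wpDl //; nra.
Qed.

Lemma modified_H_le x : 0 <= modified_H f alpha c H x <= Hmax H - Hmin H.
Proof.
have [-> /andP[_ le]] := modified_H_bounds x.
by apply: (le_trans le); rewrite lerB // le_Hmax.
Qed.

Lemma tv_modified_mu_le :
  tv_dist (modified_mu f alpha c H) (gibbs H) <=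
  expR (Hmax H - Hmin H) * (f (Hmax H - c) * (Hmax H - Hmin H)) * alpha.
Proof.
have [_ f_ge0 _ _] := hf; have /andP[cmin cmax] := hc.
have F0 : 0 <= f (Hmax H - c) by rewrite f_ge0 // subr_ge0.
have L0 : 0 <= Hmax H - Hmin H by rewrite subr_ge0 (le_trans cmin).
(* The Gibbs estimate is applied with the modified energy below [H - Hmin H], [L = Hmax H - Hmin H]
   and [d = alpha * f (Hmax H - c) * L]. *)
rewrite -(gibbs_shift H (Hmin H)) -mulrA.
apply: tv_gibbs_le => [x|x|x|].
- by have [] := modified_H_bounds x.
- by have [_ /andP[_ ->]] := modified_H_bounds x; rewrite lerB // le_Hmax.
- have [_ /andP[le _]] := modified_H_bounds x.
  have : alpha * f (Hmax H - c) * (H x - Hmin H) <=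
      alpha * f (Hmax H - c) * (Hmax H - Hmin H).
    by rewrite ler_wpM2l ?mulr_ge0 ?(ltW alpha_gt0) // lerB // le_Hmax.
  by move: le; lra.
- by rewrite !mulr_ge0 // ltW.
Qed.

End Landscape.

(* The lower bound is about the worst starting state and needs two states:
   at t = 0 the distance from x is 1 - mu^f(x), which may be below 1/2. *)
Theorem theorem4p1 (R : realType) (X : finType) (H : X -> R)
    (Q : X -> X -> R) (f : R -> R) (c : R)
    (Qgen : generator Q) (Qsym : symmetric_kernel Q)
    (Qirr : irreducible_kernel Q)
    (hf : admissible_penalty f) (hc : Hmin H <= c <= Hmax H) :
  (forall alpha : R, 0 < alpha -> forall t : R, 0 <= t ->
     ((1 < #|X|)%N ->
        2^-1 * expR (- modified_gap Q f alpha c H * t)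
        <= \big[Num.max/0]_(x : X) tv_to_eq Q f alpha c H t x)
     /\ (forall x : X,
        tv_to_eq Q f alpha c H t x
        <= expR (Hmax H - Hmin H) * #|X|%:R / 2
           * expR (- modified_gap Q f alpha c H * t)))
  /\ (exists K : R, forall alpha : R, 0 < alpha ->
        tv_dist (modified_mu f alpha c H) (gibbs H) <= K * alpha).
Proof.
split=> [alpha a0 t t0|]; last first.
  exists (expR (Hmax H - Hmin H) * (f (Hmax H - c) * (Hmax H - Hmin H))).
  by move=> alpha a0; exact: tv_modified_mu_le.
set U := modified_H f alpha c H.
have gen : generator (metropolis Q U) := generator_metropolis U Qgen.
have rev := metropolis_reversible U Qsym.
split=> [X2|x].
  have [x le] := tv_lower gen rev (gibbs_gt0 U) t X2.
  exact: le_trans le (le_bigmax _ (tv_to_eq Q f alpha c H t) x).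
apply: le_trans (tv_upper gen rev (gibbs_gt0 U) (sum_gibbs U x) x t0) _.
rewrite ler_wpM2r ?expR_ge0 // ler_wpM2r ?invr_ge0 //.
by apply: gibbs_inv_le => y; exact: modified_H_le.
Qed.
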